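(* Let $a,b,\ell\geq1$ and $k\geq2$ be integers, and let $Q_{a,b,k,\ell}$ be the three-row $0$-$1$ matrix with $a+k+b+\ell$ columns, each column containing exactly one $1$ entry, whose column word is $1^a3^k1^b2^\ell$. Every $r\times s$ $0$-$1$ matrix $M$ that avoids $Q_{a,b,k,\ell}$ satisfies \[ w(M)\leq \bigl(5(k-1)(4b+1)+a+b+\ell-1\bigr)r+2s. \] Consequently, for fixed $a,b,k,\ell$, $\operatorname{ex}(n,Q_{a,b,k,\ell})=\Theta(n)$.
   Context: Rows of a matrix are ordered from top to bottom and columns from left to right. A $0$-$1$ matrix $M$ contains a $p\times q$ $0$-$1$ matrix $Q$ if there are row indices $i_1<\cdots<i_p$ and column indices $j_1<\cdots<j_q$ of $M$ such that $M_{i_\alpha,j_\beta}=1$ whenever $Q_{\alpha,\beta}=1$ (entries of $M$ at positions where $Q$ has a $0$ are unrestricted). If $M$ does not contain $Q$, then $M$ avoids $Q$. The weight $w(M)$ is the number of $1$ entries of $M$. $\operatorname{ex}(r,s,Q)$ denotes the largest weight of an $r\times s$ $0$-$1$ matrix avoiding $Q$, and $\operatorname{ex}(n,Q)=\operatorname{ex}(n,n,Q)$. For a $0$-$1$ matrix in which every column contains exactly one $1$ entry, the column word records, for each column from left to right, the index of the row containing the $1$ entry of that column. Thus in $Q_{a,b,k,\ell}$ the first $a$ columns have their $1$ entry in row $1$, the next $k$ columns in row $3$, the next $b$ columns in row $1$, and the last $\ell$ columns in row $2$. *)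

(* Defs.v *)
From mathcomp Require Import all_boot all_order all_algebra.
From mathcomp Require Import all_classical all_reals topology normedtype landau.

Set Implicit Arguments.
Unset Strict Implicit.
Unset Printing Implicit Defensive.

Import numFieldNormedType.Exports.

Definition contains (r s p q : nat) (M : 'M[bool]_(r, s)) (Q : 'M[bool]_(p, q)) :
    Prop :=
  exists (f : 'I_p -> 'I_r) (g : 'I_q -> 'I_s),
    [/\ {homo f : i j / (i < j)%N},
        {homo g : i j / (i < j)%N}
      & forall (i : 'I_p) (j : 'I_q), Q i j -> M (f i) (g j)].

Definition avoids (r s p q : nat) (M : 'M[bool]_(r, s)) (Q : 'M[bool]_(p, q)) :
    Prop :=
  ~ contains M Q.

Definition weight (r s : nat) (M : 'M[bool]_(r, s)) : nat :=
  #|[set ij : 'I_r * 'I_s | M ij.1 ij.2]|.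

(* The maximum over an empty family is 0, but the family is nonempty as soon as
   Q has a 1 entry, since then the zero matrix avoids Q. *)
Definition extremal (r s p q : nat) (Q : 'M[bool]_(p, q)) : nat :=
  \max_(M : 'M[bool]_(r, s) | `[< avoids M Q >]) weight M.

(* Words list row numbers from 1, whereas 'I_p counts from 0. *)
Definition column_word_mx (p q : nat) (w : seq nat) : 'M[bool]_(p, q) :=
  \matrix_(i < p, j < q) (nth 0 w j == i.+1).

Definition Qmx (a b k l : nat) : 'M[bool]_(3, a + k + b + l) :=
  column_word_mx 3 (a + k + b + l)
    (nseq a 1 ++ nseq k 3 ++ nseq b 1 ++ nseq l 2).

(* Main.v *)
Require Import Defs.
From mathcomp Require Import all_boot all_order all_algebra.
From mathcomp Require Import all_classical all_reals topology normedtype landau.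
From mathcomp Require Import zify.
Import numFieldNormedType.Exports.

(* Discard the few entries of each row that cannot be the end of an initial
   [1^a] or the start of [1^b] followed by [l - 1] more entries. For an entry
   [(i, c)] let [n] be the first row below [i] with at least [l] entries to the
   right of the [b] entries of row [i] starting at [c]. Grouping each row by the
   value of [n] gives at most [2 r] classes in all. Rows below [n] have fewer than
   [k] entries between two entries of a class of row [i], since otherwise the
   pattern occurs, while after dropping [b] entries of the class, rows strictly
   between [i] and [n] have no entry there. Charge the two topmost remaining
   entries of each column to that column. Any other one lies below a class whose
   row [n] is strictly above it, and grouping these entries by such a class shows
   that there are at most [4 (k - 1)] of them per class. *)

Set Implicit Arguments.
Unset Strict Implicit.
Unset Printing Implicit Defensive.

(** * Counting in finite sets *)

Lemma card_le_fibers (T K : finType) (f : T -> K) (A : {set T}) (B : {set K}) m :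
    (forall x, x \in A -> f x \in B) ->
    (forall y, y \in B -> #|[set x in A | f x == y]| <= m) ->
  #|A| <= #|B| * m.
Proof.
move=> AB Bm; rewrite -sum1_card (partition_big f (mem B)) //=.
rewrite -sum_nat_const; apply: leq_sum => y yB.
by apply: leq_trans (Bm y yB); rewrite -sum1dep_card leq_eqVlt; apply/orP; left.
Qed.

Lemma card_ord_le2 n (A : {set 'I_n}) :
    (forall x y z : 'I_n, x \in A -> y \in A -> z \in A -> x < y -> y < z -> False) ->
  #|A| <= 2.
Proof.
move=> A3; rewrite leqNgt; apply/negP => /card_gt2P[x [y [z [[xA yA zA] [xy yz zx]]]]].
have [xy' | yx | /val_inj exy] := ltngtP x y; last by rewrite exy eqxx in xy.
- have [yz' | zy | /val_inj e] := ltngtP y z; last by rewrite e eqxx in yz.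
    exact: (A3 x y z).
  have [zx' | xz | /val_inj e] := ltngtP z x; last by rewrite e eqxx in zx.
    exact: (A3 z x y).
  exact: (A3 x z y).
have [yz' | zy | /val_inj e] := ltngtP y z; last by rewrite e eqxx in yz.
  have [zx' | xz | /val_inj e] := ltngtP z x; last by rewrite e eqxx in zx.
    exact: (A3 y z x).
  exact: (A3 y x z).
exact: (A3 z y x).
Qed.

Lemma set_argmin (T : finType) (S : {set T}) (f : T -> nat) :
  0 < #|S| -> exists2 p, p \in S & forall q, q \in S -> f p <= f q.
Proof. by case/card_gt0P => p0 p0S; case: (arg_minnP f p0S) => p pS pmin; exists p. Qed.

Lemma set_argmax (T : finType) (S : {set T}) (f : T -> nat) :
  0 < #|S| -> exists2 p, p \in S & forall q, q \in S -> f q <= f p.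
Proof. by case/card_gt0P => p0 p0S; case: (arg_maxnP f p0S) => p pS pmax; exists p. Qed.

(** * Charging entries to the classes above them *)

Section Charging.

Variables (r s m : nat) (K : finType).
Implicit Types (p q : 'I_r * 'I_s) (E : K) (c : nat).
Variables (G : {set 'I_r * 'I_s}) (cl : 'I_r * 'I_s -> K) (row top : K -> nat).

Definition hull E c :=
  [exists q1 in G, [exists q2 in G,
    [&& cl q1 == E, cl q2 == E, q1.2 <= c & c <= q2.2]]].

(** [few_below] bounds the entries of a row in the hull of [E] only strictly below [top E], so only
    such entries can be charged to [E]. *)
Definition active E p := hull E p.2 && (top E < p.1).

Lemma hullP E c :
  reflect (exists q1 q2, [/\ q1 \in G, q2 \in G, cl q1 = E, cl q2 = E
                           & q1.2 <= c <= q2.2])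
          (hull E c).
Proof.
apply: (iffP existsP) => [[q1 /andP[q1G /existsP[q2]]]|[q1 [q2 []]]].
  by case/and5P=> q2G /eqP e1 /eqP e2 l1 l2; exists q1, q2; rewrite l1 l2.
move=> q1G q2G e1 e2 /andP[l1 l2]; exists q1; rewrite q1G; apply/existsP.
by exists q2; rewrite q2G e1 e2 !eqxx l1 l2.
Qed.

Hypothesis row_cl : forall p, p \in G -> row (cl p) = p.1.
Hypothesis row_top : forall p, p \in G -> row (cl p) <= top (cl p).
Hypothesis top_le : forall E p,
  p \in G -> hull E p.2 -> row E < p.1 -> top E <= p.1.
Hypothesis few_below : forall (i : 'I_r) q1 q2,
  q1 \in G -> q2 \in G -> cl q1 = cl q2 -> top (cl q1) < i ->
  #|[set c : 'I_s | ((i, c) \in G) && (q1.2 <= c <= q2.2)]| <= m.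

(** Hull witnesses to the left of the leftmost and to the right of the rightmost entry of [S] bound
    one window containing all of [S], to which [few_below] applies. *)
Lemma card_active (i : 'I_r) E (S : {set 'I_r * 'I_s}) :
    (forall p, p \in S -> [/\ p \in G, p.1 = i & active E p]) ->
  #|S| <= m.
Proof.
move=> SP; have [->|S0] := posnP #|S|; first by [].
have [p pS pmin] := set_argmin (fun p => p.2 : nat) S0.
have [p' p'S pmax] := set_argmax (fun p => p.2 : nat) S0.
have [pG pi /andP[/hullP[q1 [_ [q1G _ e1 _ /andP[l1 _]]]] Ei]] := SP p pS.
have [p'G p'i /andP[/hullP[_ [q2 [_ q2G _ e2 /andP[_ l2]]]] _]] := SP p' p'S.
have inj2 : {in S &, injective (fun p => p.2)}.
  by move=> [u v] [u' v'] /SP[_ /= -> _] /SP[_ /= -> _] /= ->.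
rewrite -(card_in_imset inj2).
apply: leq_trans (few_below (i := i) q1G q2G _ _); last 2 first.
- by rewrite e1 e2.
- by rewrite e1 -pi.
apply/subset_leq_card/fintype.subsetP => _ /imsetP[u uS ->]; rewrite inE.
have [uG <- _] := SP u uS; rewrite -surjective_pairing uG /=.
by rewrite (leq_trans l1 (pmin u uS)) (leq_trans (pmax u uS) l2).
Qed.

Definition deep := [set p in G | [exists q1 in G, [exists q2 in G,
  [&& q1.2 == p.2, q2.2 == p.2, q1.1 < q2.1 & q2.1 < p.1]]]].

Lemma card_shallow : #|G :\: deep| <= s * 2.
Proof.
suff: #|G :\: deep| <= #|[set: 'I_s]| * 2 by rewrite cardsT card_ord.
apply: (card_le_fibers (f := fun p => p.2)) => // c _.
set S := [set x in _ | _].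
have SP p : p \in S -> [/\ p \in G, p \notin deep & p.2 = c].
  by rewrite !inE => /andP[/andP[-> ->] /eqP].
have inj1 : {in S &, injective (fun p => p.1)}.
  by move=> [u v] [u' v'] /SP[_ _ /= ->] /SP[_ _ /= ->] /= ->.
rewrite -(card_in_imset inj1); apply: card_ord_le2.
move=> _ _ _ /imsetP[x xS ->] /imsetP[y yS ->] /imsetP[z zS ->] xy yz.
have [zG /negP zd zc] := SP z zS; have [xG _ xc] := SP x xS.
have [yG _ yc] := SP y yS.
apply: zd; rewrite inE zG; apply/existsP; exists x; rewrite xG.
by apply/existsP; exists y; rewrite yG xc yc zc eqxx xy yz.
Qed.

(** The upper of the two entries above [p] gives the class. The lower one lies in its hull, so
    [top_le] puts it at or below [top], and [p] strictly below. *)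
Lemma deep_active p : p \in deep -> exists E, active E p.
Proof.
rewrite inE => /andP[pG /existsP[q1 /andP[q1G /existsP[q2]]]].
case/and5P=> q2G /eqP e1 /eqP e2 lt1 lt2; exists (cl q1).
have h : hull (cl q1) p.2 by apply/hullP; exists q1, q1; rewrite e1 leqnn.
rewrite /active h /=; apply: leq_ltn_trans lt2.
by apply: top_le; rewrite ?e2 ?row_cl.
Qed.

Definition leftc p := [exists q in G, active (cl q) p &&
  [forall p' in G, (cl p' == cl p) ==> (q.2 <= p'.2)]].

Definition rightc p := [exists q in G, active (cl q) p &&
  [forall p' in G, (cl p' == cl p) ==> (p'.2 <= q.2)]].

(** Fix a class [B]. The active class chosen for its rightmost counted entry has an entry weakly
    left of all of [B], so its hull covers every counted entry of [B], and these share a row. *)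
Lemma card_leftc : #|[set p in deep | leftc p]| <= #|cl @: G| * m.
Proof.
apply: (card_le_fibers (f := cl)) => [p|B _].
  by rewrite !inE => /andP[/andP[pG _] _]; apply: imset_f.
set S := [set x in _ | _].
have SP p : p \in S -> [/\ p \in G, leftc p & cl p = B].
  by rewrite !inE => /andP[/andP[/andP[-> _] ->] /eqP].
have [->//|S0] := posnP #|S|.
have [p pS pmax] := set_argmax (fun p => p.2 : nat) S0.
have [pG /existsP[q /and3P[qG qa /'forall_implyP qle]] pB] := SP p pS.
case/andP: (qa) => /hullP[_ [q2 [_ q2G _ e2 /andP[_ l2]]]] qi.
apply: (card_active (i := p.1) (E := cl q)) => u uS; have [uG _ uB] := SP u uS.
have up : u.1 = p.1 by apply: val_inj; rewrite /= -!row_cl // uB pB.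
split=> //; rewrite /active up qi andbT; apply/hullP; exists q, q2; split=> //.
rewrite (leq_trans (pmax u uS) l2) andbT.
by have /implyP := qle u uG; apply; rewrite uB pB.
Qed.

Lemma card_rightc : #|[set p in deep | rightc p]| <= #|cl @: G| * m.
Proof.
apply: (card_le_fibers (f := cl)) => [p|B _].
  by rewrite !inE => /andP[/andP[pG _] _]; apply: imset_f.
set S := [set x in _ | _].
have SP p : p \in S -> [/\ p \in G, rightc p & cl p = B].
  by rewrite !inE => /andP[/andP[/andP[-> _] ->] /eqP].
have [->//|S0] := posnP #|S|.
have [p pS pmin] := set_argmin (fun p => p.2 : nat) S0.
have [pG /existsP[q /and3P[qG qa /'forall_implyP qle]] pB] := SP p pS.
case/andP: (qa) => /hullP[q1 [_ [q1G _ e1 _ /andP[l1 _]]]] qi.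
apply: (card_active (i := p.1) (E := cl q)) => u uS; have [uG _ uB] := SP u uS.
have up : u.1 = p.1 by apply: val_inj; rewrite /= -!row_cl // uB pB.
split=> //; rewrite /active up qi andbT; apply/hullP; exists q1, q; split=> //.
rewrite (leq_trans l1 (pmin u uS)) /=.
by have /implyP := qle u uG; apply; rewrite uB pB.
Qed.

(** For these entries the hull of every active class lies strictly inside the hull of the entry's
    own class. *)
Definition inner := [set p in deep | ~~ leftc p && ~~ rightc p].

(* If inner entries of three rows chose the same class, the class of the topmost
   one would cover the lowest one, be active for it, and start lower. *)
Definition lowest_active p :=
  odflt (cl p) [pick E | active E p && [forall E', active E' p ==> (row E' <= row E)]].

Lemma lowest_activeP p : p \in deep ->
  active (lowest_active p) p /\ forall E, active E p -> row E <= row (lowest_active p).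
Proof.
case/deep_active => E0 aE0; rewrite /lowest_active; case: pickP => [E|noE] /=.
  by case/andP=> -> /'forall_implyP.
have S0 : 0 < #|[set E | active E p]| by apply/card_gt0P; exists E0; rewrite inE.
have [E] := set_argmax row S0; rewrite inE => aE Emax.
have /negP[] := negbT (noE E); rewrite aE; apply/'forall_implyP => E' aE'.
by apply: Emax; rewrite inE.
Qed.

Lemma card_inner : #|inner| <= #|cl @: G| * (2 * m).
Proof.
apply: (card_le_fibers (f := lowest_active)) => [p|E _].
  rewrite inE => /andP[/lowest_activeP[/andP[/hullP[q [_ [qG _ <- _ _]]] _] _] _].
  exact: imset_f.
set S := [set x in _ | _].
have SP p : p \in S -> [/\ p \in G, p \in deep, ~~ leftc p, ~~ rightc p & lowest_active p = E].
  rewrite inE [p \in inner]inE => /andP[/and3P[pd -> ->] /eqP]; rewrite pd.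
  by move: pd; rewrite inE => /andP[-> _].
have aE p : p \in S -> active E p.
  by case/SP=> _ /lowest_activeP[ap _] _ _ <-.
(* The fibre of [E] is cut by rows: each row contributes at most [m], and at most two rows occur. *)
apply: leq_trans (card_le_fibers (f := fun p => p.1) (B := [set p.1 | p in S]) (m := m) _ _) _.
- by move=> p pS; apply: imset_f.
- move=> i _; apply: (card_active (i := i) (E := E)) => p; rewrite inE => /andP[pS /eqP pi].
  by have [pG _ _ _ _] := SP p pS; split=> //; apply: aE.
rewrite leq_mul2r; apply/orP; right; apply: card_ord_le2.
move=> _ _ _ /imsetP[x xS ->] /imsetP[y yS ->] /imsetP[z zS ->] xy yz.
have [xG _ xl xr _] := SP x xS.
move/exists_inPn in xl; move/exists_inPn in xr.
(* Since [x] is inner, the hull of [E] lies inside that of [cl x], which therefore covers the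
   columns of all of [S]. *)
have inB u : u \in S -> hull (cl x) u.2.
  move=> uS; have [uG _ _ _ _] := SP u uS.
  have [/hullP[q1 [q2 [q1G q2G e1 e2 /andP[l1 l2]]]] _] := andP (aE u uS).
  have [p1 p1G /andP[/eqP p1B lt1]] :
      exists2 p', p' \in G & (cl p' == cl x) && (p'.2 < q1.2).
    have := xl q1 q1G; rewrite e1 aE //= => /forall_inPn[p' p'G].
    by rewrite negb_imply -ltnNge => ?; exists p'.
  have [p2 p2G /andP[/eqP p2B lt2]] :
      exists2 p', p' \in G & (cl p' == cl x) && (q2.2 < p'.2).
    have := xr q2 q2G; rewrite e2 aE //= => /forall_inPn[p' p'G].
    by rewrite negb_imply -ltnNge => ?; exists p'.
  apply/hullP; exists p1, p2; split=> //.
  by rewrite (leq_trans (ltnW lt1) l1) (leq_trans l2 (ltnW lt2)).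
have [yG _ _ _ _] := SP y yS; have [zG zd _ _ zE] := SP z zS.
have topy : top (cl x) <= y.1.
  by apply: top_le; rewrite ?row_cl // inB.
have [_ zmax] := lowest_activeP zd.
have /zmax : active (cl x) z.
  by rewrite /active inB ?(leq_ltn_trans topy).
rewrite zE row_cl // leqNgt => /negP; apply.
(* As [E] is active for [x], [row E <= top E < x.1], against the maximality of [row E] for [z]. *)
case/andP: (aE x xS) => /hullP[q [_ [qG _ <- _ _]]].
by apply: leq_ltn_trans; apply: row_top.
Qed.

(** The factor 4 is 1 + 1 + 2, from left, right and inner entries; shallow entries give [2 * s]. *)
Lemma charging : #|G| <= 2 * s + 4 * m * #|cl @: G|.
Proof.
have sub : G \subset (G :\: deep) :|: ([set p in deep | leftc p] :|:
    ([set p in deep | rightc p] :|: inner)).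
  apply/fintype.subsetP => p pG; rewrite !(finset.in_setU, finset.in_setD, finset.in_set) pG andbT /=.
  by case: existsP => //= _; case: leftc; case: rightc.
apply: leq_trans (subset_leq_card sub) _.
have := card_shallow; have := card_leftc; have := card_rightc; have := card_inner.
set N := #|cl @: G| => h1 h2 h3 h4.
have u1 := (leq_card_setU (G :\: deep)
  ([set p in deep | leftc p] :|: ([set p in deep | rightc p] :|: inner))).1.
have u2 := (leq_card_setU [set p in deep | leftc p] ([set p in deep | rightc p] :|: inner)).1.
have u3 := (leq_card_setU [set p in deep | rightc p] inner).1.
rewrite mulnCA in h1; rewrite -mulnA (mulnC m); lia.
Qed.

End Charging.

(** * Classes of entries in an avoiding matrix *)

Section Rows.

Variables (r s : nat) (M : 'I_r -> 'I_s -> bool).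
Implicit Types (i j : 'I_r) (c : 'I_s) (u v w t : nat).

Definition ones i u v := #|[set c : 'I_s | M i c && (u <= c < v)]|.

Lemma ones_sub i u v u' v' : u' <= u -> v <= v' -> ones i u v <= ones i u' v'.
Proof.
move=> uu vv; apply/subset_leq_card/fintype.subsetP => c; rewrite !inE => /and3P[-> uc cv] /=.
by rewrite (leq_trans uu uc) (leq_trans cv vv).
Qed.

Lemma ones_cat i u v w : ones i u w <= ones i u v + ones i v w.
Proof.
apply: leq_trans (leq_card_setU _ _).1.
apply/subset_leq_card/fintype.subsetP => c; rewrite !inE => /and3P[-> -> ->] /=.
by rewrite andbT; case: ltnP.
Qed.

Lemma ones_gt0 i u v : 0 < ones i u v -> u < v.
Proof. by case/card_gt0P => c; rewrite inE => /and3P[_ uc /(leq_ltn_trans uc)]. Qed.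

(** The window ending at the rightmost member contains all members. *)
Lemma card_prefix i u t :
  #|[set c | [&& M i c, u <= c & ones i u c.+1 <= t]]| <= t.
Proof.
set S := [set c | _].
have [->//|S0] := posnP #|S|.
have [c cS cmax] := set_argmax (fun c => c : nat) S0.
move: (cS); rewrite inE => /and3P[_ _ ct]; apply: leq_trans ct.
apply/subset_leq_card/fintype.subsetP => c' c'S; have := cmax c' c'S.
by move: c'S; rewrite !inE ltnS => /and3P[-> -> _] ->.
Qed.

Lemma card_suffix i t : #|[set c | M i c && (ones i c s <= t)]| <= t.
Proof.
set S := [set c | _].
have [->//|S0] := posnP #|S|.
have [c cS cmin] := set_argmin (fun c => c : nat) S0.
move: (cS); rewrite inE => /andP[_ ct]; apply: leq_trans ct.
apply/subset_leq_card/fintype.subsetP => c' c'S; have := cmin c' c'S.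
by move: c'S; rewrite !inE ltn_ord => /andP[-> _] ->.
Qed.

Variables (a b k l : nat).
Hypotheses (a0 : 0 < a) (b0 : 0 < b) (k0 : 0 < k) (l0 : 0 < l).
Hypothesis M_avoids : forall i1 i2 i3 u v w, i1 < i2 -> i2 < i3 ->
  a <= ones i1 0 u -> k <= ones i3 u v -> b <= ones i1 v w -> l <= ones i2 w s ->
  False.

(** The bound [b + l - 1] ensures that if fewer than [l] ones of the row lie from a column [e] on,
    then at least [b] lie from [c] up to [e]. *)
Definition core i c := [&& M i c, a <= ones i 0 c.+1 & b + l - 1 <= ones i c s].

(* Row [j] can provide the [2^l] part for a copy whose [1^b] part starts at [c]
   in row [i]; then no row below [j] can provide the [3^k] part. *)
Definition hit i c j :=
  (i < j) && [exists e : 'I_s.+1, (b <= ones i c e) && (l <= ones j e s)].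

Lemma hitI i c j (e : 'I_s) : i < j -> b <= ones i c e -> l <= ones j e s -> hit i c j.
Proof.
move=> ij be le; rewrite /hit ij; apply/existsP.
by exists (widen_ord (leqnSn s) e); rewrite be le.
Qed.

(* Equal to [r] when no row is hit. *)
Definition first_hit i c : 'I_r.+1 := inord (find (hit i c) (enum 'I_r)).

Lemma first_hitE i c : first_hit i c = find (hit i c) (enum 'I_r) :> nat.
Proof. by rewrite inordK // ltnS -[X in _ <= X](size_enum_ord r) find_size. Qed.

Lemma first_hit_le i c j : hit i c j -> first_hit i c <= j.
Proof.
move=> h; rewrite first_hitE leqNgt; apply/negP => /(before_find j).
by rewrite nth_ord_enum h.
Qed.

Lemma hit_first_hit i c j : first_hit i c = j :> nat -> hit i c j.
Proof.
rewrite first_hitE => e; have : has (hit i c) (enum 'I_r).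
  by rewrite has_find size_enum_ord e.
by move/(nth_find j); rewrite e nth_ord_enum.
Qed.

Lemma first_hit_gt i c : i < first_hit i c.
Proof.
have [lt|] := ltnP (first_hit i c) r; last exact: leq_trans.
by have /andP[] := hit_first_hit (i := i) (c := c) (j := Ordinal lt) erefl.
Qed.

(** Otherwise [1^a] ends at [x], row [j] gives [3^k] between [x] and [y], [1^b] starts at [y], and
    the first hit row of [y] gives [2^l]. *)
Lemma core_few i x y (j : 'I_r) :
  core i x -> core i y -> first_hit i y < j -> ones j x.+1 y < k.
Proof.
move=> /and3P[_ ax _] _ yj; rewrite ltnNge; apply/negP => kxy.
have lt : first_hit i y < r by apply: ltn_trans yj _.
have /andP[ij /existsP[e /andP[be le]]] :=
  hit_first_hit (i := i) (c := y) (j := Ordinal lt) erefl.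
exact: (M_avoids ij yj ax kxy be le).
Qed.

Definition cls (p : 'I_r * 'I_s) := (p.1, first_hit p.1 p.2).
Lemma cls_eq p q : cls p = cls q -> p.1 = q.1 /\ first_hit q.1 p.2 = first_hit q.1 q.2.
Proof.
move=> e; have e1 : p.1 = q.1 := congr1 fst e; split=> //.
by have := congr1 snd e; rewrite /cls /= e1.
Qed.

Definition cores := [set p : 'I_r * 'I_s | core p.1 p.2].

(* The trimming on the left makes rows strictly between a class and its first
   hit row have no core entry within the hull of the good entries. *)
Definition goods := [set p in cores |
  [exists x in cores, (cls x == cls p) && (b <= ones p.1 x.2 p.2)] &&
  [exists y in cores, (cls y == cls p) && (p.2 < y.2)]].

Lemma goodsP p : p \in goods ->
  [/\ core p.1 p.2,
      exists x, [/\ core p.1 x, first_hit p.1 x = first_hit p.1 p.2 & b <= ones p.1 x p.2]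
    & exists y, [/\ core p.1 y, first_hit p.1 y = first_hit p.1 p.2 & p.2 < y]].
Proof.
rewrite inE [p \in cores]inE => /and3P[cp].
case/existsP=> x /and3P[+ /eqP/cls_eq[ex nx] bx]; rewrite inE ex => cx.
case/existsP=> y /and3P[+ /eqP/cls_eq[ey ny] lt]; rewrite inE ey => cy.
by split=> //; [exists x.2 | exists y.2].
Qed.

Lemma goods_charging : #|goods| <= 2 * s + 4 * (k - 1) * #|cls @: goods|.
Proof.
apply: (charging (row := fun E : 'I_r * 'I_r.+1 => E.1)
                 (top := fun E : 'I_r * 'I_r.+1 => E.2)) => //=.
- by move=> p _; apply/ltnW/first_hit_gt.
- move=> E p /goodsP[/and3P[_ _ lp] _ _] /hullP[q1 [q2 [q1G _ <- _ /andP[l1 _]]]] /= lt.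
  (* At least [b] ones separate [x] from [q1], and the core entry [p] has [l] ones from its column
     on, so the row of [p] is hit from [x]. *)
  have [_ [x [_ <- bx]] _] := goodsP q1G.
  apply: first_hit_le; apply: (hitI (e := p.2)) => //.
    by apply: leq_trans bx _; apply: ones_sub.
  by apply: leq_trans lp; lia.
move=> i q1 q2 /goodsP[_ [x [cx ex bx]] _] /goodsP[_ _ [y [cy ey ly]]] /cls_eq[e1 e2] ni.
rewrite /= e1 in cx ex bx e2 ni *.
have := core_few (i := q2.1) (x := x) (y := y) (j := i).
rewrite ey -e2 => /(_ cx cy ni) lt.
rewrite -ltnS subn1 prednK //; apply: leq_ltn_trans lt.
apply/subset_leq_card/fintype.subsetP => c; rewrite !inE.
move=> /andP[/andP[/and3P[-> _ _] _]] /andP[qc cq] /=.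
by rewrite (leq_trans _ qc) ?(leq_ltn_trans cq) // (ones_gt0 (leq_trans b0 bx)).
Qed.

(* Besides the last class of each row, a class is determined by its first hit
   row [n]: its row is the lowest one above [n] reaching further right than [n]. *)
Lemma card_cls : #|cls @: cores| <= r * 2.
Proof.
set K := cls @: cores.
pose K1 := [set E in K | [exists E' in K, (E'.1 == E.1) && (E.2 < E'.2)]].
have KP E : E \in K -> exists2 x, core E.1 x & E.2 = first_hit E.1 x.
  by case/imsetP => -[i x]; rewrite inE => /= cx ->; exists x.
have card1 : #|K1| <= r.
  have inj : {in K1 &, injective (fun E => E.2)}.
    suff no i j n : (i, n) \in K1 -> (j, n) \in K1 -> i < j -> False.
      move=> [i n] [j n'] iK jK /= e; rewrite -e in jK *.
      by have [/(no _ _ _ iK jK)|/(no _ _ _ jK iK)|/val_inj ->] := ltngtP i j.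
    rewrite !inE => /andP[/KP[/= x _ ex] /existsP[E0 /and3P[_ _ /= nlt]]].
    move=> /andP[/KP[/= z _ ez] /existsP[[j' n'] /and3P[E'K /eqP /= ejj nlt']]] ij.
    subst j'.
    have [/= y cy ey] := KP _ E'K.
    (* A later class in the same row makes [n] an actual row, not the default [r]. *)
    have nr : n < r by rewrite (leq_trans nlt) // -ltnS.
    have jn : j < n by rewrite ez first_hit_gt.
    have /andP[_ /existsP[e /andP[be le]]] :=
      hit_first_hit (i := i) (c := x) (j := Ordinal nr) (esym (congr1 val ex)).
    (* Row [j] lies strictly between [i] and the first hit row [n], so it is not hit from [x]. *)
    have je : ones j e s < l.
      rewrite ltnNge; apply/negP => le'.
      have : first_hit i x <= j.
        by apply: first_hit_le; rewrite /hit ij; apply/existsP; exists e; rewrite be.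
      by rewrite -ex leqNgt jn.
    (* Row [j] has fewer than [l] ones from [e] on, hence at least [b] from [y] to [e]; so [n] is
       hit from [y], contradicting [n < n']. *)
    have := nlt'; rewrite ey ltnNge => /negP; apply.
    apply: (first_hit_le (j := Ordinal nr)); rewrite /hit jn; apply/existsP; exists e.
    rewrite le andbT; case/and3P: cy => _ _ cy.
    have := ones_cat j y e s; lia.
  rewrite -(card_in_imset inj) -[X in _ <= X](card_ord r).
  have -> : #|'I_r| = #|[set~ (ord_max : 'I_r.+1)]| by rewrite cardsC1 !card_ord.
  apply/subset_leq_card/fintype.subsetP => _ /imsetP[E + ->]; rewrite !inE.
  case/andP=> _ /existsP[E' /and3P[_ _ lt]]; apply/eqP => e.
  by move: lt; rewrite e /= ltnNge -ltnS ltn_ord.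
have card2 : #|K :\: K1| <= r.
  have inj : {in K :\: K1 &, injective (fun E => E.1)}.
    move=> [i n] [i' n'] /finset.setDP[EK EK1] /finset.setDP[EK' EK1'] /= e; rewrite -e in EK' EK1' *.
    have [lt|lt|/val_inj -> //] := ltngtP n n'.
      case/negP: EK1; rewrite inE EK; apply/existsP; exists (i, n').
      by rewrite EK' eqxx lt.
    case/negP: EK1'; rewrite inE EK'; apply/existsP; exists (i, n).
    by rewrite EK eqxx lt.
  rewrite -(card_in_imset inj) -[X in _ <= X](card_ord r); exact: max_card.
rewrite -(cardsID K1 K) muln2 -addnn leq_add //.
by apply: leq_trans card1; apply/subset_leq_card/finset.subsetIr.
Qed.

(** * Discarded entries and the total count *)

(** A class loses its rightmost entry and those with fewer than [b] ones of the row between its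
    leftmost entry (included) and them, at most [b] in number. *)
Lemma card_nongood : #|cores :\: goods| <= #|cls @: cores| * (b + 1).
Proof.
apply: (card_le_fibers (f := cls)) => [p /finset.setDP[pc _]|E _]; first exact: imset_f.
pose C := [set p in cores | cls p == E].
have [C0|C0] := posnP #|C|.
  rewrite (_ : [set x in _ | _] = finset.set0) ?cards0 //; apply/finset.setP => p.
  move/eqP: C0; rewrite cards_eq0 => /eqP/finset.setP/(_ p); rewrite !inE => C0.
  by apply: contraFF C0 => /andP[/andP[_ ->] ->].
have [x xC xmin] := set_argmin (fun p : 'I_r * 'I_s => p.2 : nat) C0.
have [y yC ymax] := set_argmax (fun p : 'I_r * 'I_s => p.2 : nat) C0.
have CP p : p \in C -> [/\ p \in cores, cls p = E & p.1 = E.1].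
  by rewrite inE => /andP[-> /eqP <-].
pose P := [set c | [&& M E.1 c, x.2 <= c & ones E.1 x.2 c.+1 <= b]].
have sub : [set p in cores :\: goods | cls p == E] \subset
    [set (E.1, c) | c in P] :|: [set y].
  apply/fintype.subsetP => p; rewrite inE => /andP[/finset.setDP[pcore png] /eqP pE].
  have pC : p \in C by rewrite inE pcore pE eqxx.
  have [_ _ p1] := CP p pC; have [xcore xE _] := CP x xC.
  have [ycore yE y1] := CP y yC.
  rewrite !inE; have [py|] := ltnP p.2 y.2; last first.
    move=> yp; apply/orP; right; apply/eqP; rewrite [p]surjective_pairing [y]surjective_pairing.
    by rewrite p1 y1; congr pair; apply: val_inj; apply/eqP; rewrite eqn_leq yp ymax.
  apply/orP; left; apply/imsetP; exists p.2; last by rewrite -p1 -surjective_pairing.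
  move: (pcore); rewrite inE => /and3P[Mp _ _]; rewrite inE -p1 Mp xmin //=.
  have lt : ones p.1 x.2 p.2 < b.
    rewrite ltnNge; apply: contra png => bx; rewrite inE pcore /=; apply/andP; split.
      by apply/existsP; exists x; rewrite xcore xE pE eqxx.
    by apply/existsP; exists y; rewrite ycore yE pE eqxx.
  apply: leq_trans lt; apply: leq_trans (ones_cat _ _ p.2 _) _.
  rewrite -[X in _ <= X]addn1 leq_add2l.
  rewrite -(cards1 p.2); apply/subset_leq_card/fintype.subsetP => c.
  by rewrite !inE ltnS -eqn_leq => /andP[_ /eqP e]; apply/eqP/val_inj.
apply: leq_trans (subset_leq_card sub) _; apply: leq_trans (leq_card_setU _ _).1 _.
rewrite cards1 leq_add2r; apply: leq_trans (leq_imset_card _ _) _.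
exact: card_prefix.
Qed.

Lemma card_noncore :
  #|[set p : 'I_r * 'I_s | M p.1 p.2] :\: cores| <= r * (a - 1 + (b + l - 2)).
Proof.
suff: #|[set p : 'I_r * 'I_s | M p.1 p.2] :\: cores| <= #|[set: 'I_r]| * (a - 1 + (b + l - 2)).
  by rewrite cardsT card_ord.
apply: (card_le_fibers (f := fun p => p.1)) => // i _.
pose A := [set c | [&& M i c, 0 <= c & ones i 0 c.+1 <= a - 1]].
pose B := [set c | M i c && (ones i c s <= b + l - 2)].
have sub : [set x in [set p | M p.1 p.2] :\: cores | x.1 == i] \subset
    [set (i, c) | c in A :|: B].
  apply/fintype.subsetP => -[j c]; rewrite !inE /core /= => /andP[/andP[nc Mc] /eqP ji].
  subst j; apply/imsetP; exists c => //; move: nc; rewrite !inE Mc /=; lia.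
apply: leq_trans (subset_leq_card sub) _; apply: leq_trans (leq_imset_card _ _) _.
apply: leq_trans (leq_card_setU _ _).1 _; apply: leq_add.
  exact: card_prefix.
exact: card_suffix.
Qed.

(** There are at most [2 * r] classes, each costing [b + 1] discarded and [4 * (k - 1)] charged
    entries; the rest is [card_noncore] and two entries per column. *)
Lemma card_all_ones : #|[set p : 'I_r * 'I_s | M p.1 p.2]| <=
  (a - 1 + (b + l - 2) + 2 * (b + 1) + 8 * (k - 1)) * r + 2 * s.
Proof.
have h1 := card_noncore; have h2 := card_nongood; have h3 := goods_charging.
have h4 := card_cls.
have GC : goods \subset cores by apply/fintype.subsetP => p; rewrite inE => /andP[].
have CM : cores \subset [set p | M p.1 p.2].
  by apply/fintype.subsetP => p; rewrite !inE => /and3P[].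
have h5 := subset_leq_card (finset.imsetS cls GC).
rewrite -(cardsID cores) (finset.setIidPr CM) -(cardsID goods cores) (finset.setIidPr GC).
nia.
Qed.

End Rows.

(** * Building a copy of the pattern *)

Lemma card_set_filter (T : finType) (P : pred T) :
  #|[set x | P x]| = size [seq x <- enum T | P x].
Proof. by rewrite -sum1dep_card sum1_count size_filter /index_enum -enumT. Qed.

Lemma contains_Qmx (r s : nat) (M : 'M[bool]_(r, s)) a b k l (i1 i2 i3 : 'I_r) u v w :
    0 < a -> 0 < k -> 0 < b -> i1 < i2 -> i2 < i3 ->
    a <= ones M i1 0 u -> k <= ones M i3 u v -> b <= ones M i1 v w -> l <= ones M i2 w s ->
  contains M (Qmx a b k l).
Proof.
move=> a0 k0 b0 i12 i23 au kv bw ls.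
pose seg n i u v := take n [seq c <- enum 'I_s | M i c && (u <= c < v)].
have seg_size n i u' v' : n <= ones M i u' v' -> size (seg n i u' v') = n.
  by move=> nu; rewrite size_takel // -card_set_filter.
have seg_all n i u' v' : all (fun c => M i c && (u' <= c < v')) (seg n i u' v').
  by apply/allP => c /mem_take; rewrite mem_filter => /andP[].
have seg_sorted n i u' v' : pairwise (fun c d : 'I_s => c < d) (seg n i u' v').
  apply: (subseq_pairwise (take_subseq _ _)); apply: pairwise_filter.
  have := iota_ltn_sorted 0 s; rewrite sorted_pairwise; last exact: ltn_trans.
  by rewrite -val_enum_ord pairwise_map.
pose S := seg a i1 0 u ++ seg k i3 u v ++ seg b i1 v w ++ seg l i2 w s.
pose W := nseq a 1 ++ nseq k 3 ++ nseq b 1 ++ nseq l 2.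
have [x0 _] : exists x0, x0 \in [set c | M i1 c && (0 <= c < u)].
  by apply/card_gt0P; apply: leq_trans au.
have sizeS : size S = a + k + b + l by rewrite !size_cat !seg_size // !addnA.
have sizeW : size W = a + k + b + l by rewrite !size_cat !size_nseq !addnA.
have S_sorted : sorted (fun c d : 'I_s => c < d) S.
  rewrite sorted_pairwise; last by move=> ? ? ?; apply: ltn_trans.
  rewrite !pairwise_cat !seg_sorted !allrel_catr !andbT /=.
  (* A nonempty window has its bounds in order. *)
  have uv : u <= v by have [c] := card_gt0P (leq_trans k0 kv); rewrite inE => /and3P[_]; lia.
  have vw : v <= w by have [c] := card_gt0P (leq_trans b0 bw); rewrite inE => /and3P[_]; lia.
  have lt n n' i i' u1 v1 u2 v2 : v1 <= u2 ->
      allrel (fun c d : 'I_s => c < d) (seg n i u1 v1) (seg n' i' u2 v2).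
    move=> le; apply/allrelP => c d /(allP (seg_all _ _ _ _)) /and3P[_ _ cv].
    move=> /(allP (seg_all _ _ _ _)) /and3P[_ ud _].
    exact: leq_trans cv (leq_trans le ud).
  by rewrite !lt // (leq_trans uv).
pose row n := nth i1 [:: i1; i2; i3] n.
(* Letters of the word start at 1, hence the predecessor. *)
have WS : all (fun p => M (row p.1.-1) p.2) (zip W S).
  have zseg n m i u' v' : n <= ones M i u' v' -> row m.-1 = i ->
      all (fun p => M (row p.1.-1) p.2) (zip (nseq n m) (seg n i u' v')).
    move=> le mi; apply/(all_nthP (0, x0)) => j.
    rewrite size_zip size_nseq seg_size // minnn => jn.
    rewrite nth_zip ?size_nseq ?seg_size //= nth_nseq jn mi.
    by have /(all_nthP x0)/(_ j) := seg_all n i u' v'; rewrite seg_size // => /(_ jn)/andP[].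
  by rewrite !zip_cat ?size_nseq ?seg_size // !all_cat !zseg.
exists (fun i : 'I_3 => row i), (fun j : 'I_(a + k + b + l) => nth x0 S j); split.
- case=> [[|[|[|//]]] ?] [[|[|[|//]]] ?] //= _; exact: ltn_trans i23.
- move=> i j ij; apply: (sorted_ltn_nth _ _ S_sorted) => //.
  + by move=> ? ? ?; apply: ltn_trans.
  + by rewrite inE sizeS.
  + by rewrite inE sizeS.
move=> i j; rewrite /Qmx /column_word_mx mxE => /eqP Wj.
have := all_nthP (0, x0) WS j; rewrite size_zip sizeS sizeW minnn nth_zip ?sizeS ?sizeW //=.
by rewrite Wj; apply.
Qed.

(** * Linear growth and the final bound *)

(** The matrix whose ones fill the top row avoids the pattern, which has ones in two distinct
    rows. *)
Lemma extremal_ge (a b k l n : nat) : 0 < a -> 0 < l -> n <= extremal n n (Qmx a b k l).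
Proof.
move=> a0 l0; case: n => [//|n].
pose M : 'M[bool]_n.+1 := (\matrix_(i, j) (i == ord0))%R.
have wM : weight M = n.+1.
  rewrite /weight; have -> : [set p : 'I_n.+1 * 'I_n.+1 | M p.1 p.2] =
      [set (ord0, c) | c : 'I_n.+1] :> {set _}.
    apply/finset.setP => -[i c]; rewrite !inE mxE /=; apply/eqP/imsetP => [->|[c' _ [-> _]] //].
    by exists c.
  by rewrite card_imset ?card_ord // => c c' [].
rewrite -{1}wM; apply: (@leq_bigmax_cond _ _ (fun M => weight M)); apply/asboolP.
case=> f [g [f_homo _ Mfg]].
have lt1 : 0 < a + k + b + l by lia.
have lt2 : a + k + b < a + k + b + l by lia.
have M1 : M (f ord0) (g (Ordinal lt1)).
  by apply: Mfg; rewrite mxE /= nth_cat size_nseq a0 nth_nseq a0.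
have M2 : M (f (inord 1)) (g (Ordinal lt2)).
  apply: Mfg; rewrite mxE /= !catA nth_cat !size_cat !size_nseq ltnn subnn.
  by rewrite nth_nseq l0 inordK.
have := f_homo ord0 (inord 1); rewrite inordK // => /(_ isT).
by move: M1 M2; rewrite !mxE => /eqP -> /eqP ->.
Qed.

Lemma Theta_id (R : realType) (u : nat -> nat) C :
    (forall n, n <= u n <= C * n) ->
  ((fun n => (u n)%:R : R^o) \is 'Theta_(\oo%classic) (fun n : nat => n%:R : R^o))%R.
Proof.
(* The upper constant is [C.+1] so that it is positive even for [C = 0]. *)
move=> uC; rewrite qualifE; apply/asboolP; exists (1%R, C.+1%:R)%R => /=.
  by rewrite Num.Theory.ltr01 Num.Theory.ltr0n.
near=> n; rewrite GRing.Theory.mul1r !Num.Theory.normr_nat -GRing.Theory.natrM !Num.Theory.ler_nat.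
have /andP[-> h] := uC n; split=> //; apply: leq_trans h _; rewrite leq_mul //.
Unshelve. all: by end_near. Qed.

Lemma weight_avoids_Qmx (a b k l r s : nat) (M : 'M[bool]_(r, s)) :
    0 < a -> 0 < b -> 1 < k -> 0 < l -> avoids M (Qmx a b k l) ->
  weight M <= (5 * (k - 1) * (4 * b + 1) + a + b + l - 1) * r + 2 * s.
Proof.
move=> a0 b0 k1 l0 Mav; have k0 := ltnW k1.
apply: leq_trans (card_all_ones a0 b0 k0 l0 _) _.
  move=> i1 i2 i3 u v w i12 i23 au kv bw ls.
  by apply: Mav; apply: (contains_Qmx a0 k0 b0 i12 i23 au kv bw ls).
(* What remains is [2 * b + 8 * (k - 1) <= 5 * (k - 1) * (4 * b + 1)]. *)
rewrite leq_add2r leq_mul2r; apply/orP; right.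
case: k k1 {k0 Mav} => [|[|k]] // _; nia.
Qed.

Theorem theorem1p2 (a b k l : nat)
    (ha : 1 <= a) (hb : 1 <= b) (hl : 1 <= l) (hk : 2 <= k) :
  (forall (r s : nat) (M : 'M[bool]_(r, s)),
     avoids M (Qmx a b k l) ->
     weight M <= (5 * (k - 1) * (4 * b + 1) + a + b + l - 1) * r + 2 * s) /\
  (forall R : realType,
     ((fun n : nat => (extremal n n (Qmx a b k l))%:R : R^o)
        \is 'Theta_(\oo%classic) (fun n : nat => n%:R : R^o))%R).
Proof.
split=> [r s M|R]; first exact: weight_avoids_Qmx.
(* For square matrices the term [2 * s] adds 2 to the coefficient. *)
apply: (@Theta_id R _ (5 * (k - 1) * (4 * b + 1) + a + b + l - 1 + 2)) => n.
rewrite extremal_ge //=; apply/bigmax_leqP => M /asboolP.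
by rewrite mulnDl; apply: weight_avoids_Qmx.
Qed.
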